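(* Let $n\geq 2$, $G=\operatorname{Sym}(n)$, and let $H\leq G$ be such that $(G,H)$ is a Gelfand pair and $[n-1,1]$ is the second largest partition in dominance order in $\Lambda(n,H)$. Let $\Omega=G/H$ (with $G$ acting by left multiplication) and let $\mathcal S$ be one of the two orbits of $K=\operatorname{Sym}([n-1,1])=\operatorname{Sym}(n-1)\times\operatorname{Sym}(1)$ on $\Omega$. Let $X$ be an orbital digraph of $G$ on $\Omega$ in which every vertex has out-degree $d$. If $\mathcal S$ is a coclique of $X$ (no arc of $X$ joins two elements of $\mathcal S$), then $-\dfrac{d\,|\mathcal S|}{|\Omega|-|\mathcal S|}$ is the eigenvalue of $X$ afforded by the $[n-1,1]$-module.
   Context: $(G,H)$ is a Gelfand pair if $1_H^G$ is multiplicity-free; $\Lambda(n,H)=\{\lambda\vdash n:\langle 1_H^G,\chi^\lambda\rangle=1\}$. Under these hypotheses $K$ has exactly two orbits on $\Omega$. An orbital digraph has vertex set $\Omega$ and arc set an orbit of $G$ on $\Omega\times\Omega$. Eigenvalue afforded by the $\lambda$-module: the adjacency matrix of $X$ commutes with the action of $G$ on $\mathbb C^\Omega$, which is a multiplicity-free sum of irreducible modules, one isomorphic to the Specht module $S^\lambda$ for each $\lambda\in\Lambda(n,H)$; the adjacency matrix acts on that summand as a scalar, the eigenvalue afforded by the $\lambda$-module. *)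

(* Defs.v *)
From HB Require Import structures.
From mathcomp Require Import all_boot all_order all_algebra.
From mathcomp Require Import all_fingroup all_field all_character.

Set Implicit Arguments.
Unset Strict Implicit.
Unset Printing Implicit Defensive.

Import GroupScope Order.TTheory GRing.Theory Num.Theory.
Local Open Scope ring_scope.

(* Left multiplication on subsets.  Mathcomp actions are right actions, so     *)
(* g acts by g^-1; the orbits are those of left multiplication.                *)
Section LeftMultiplication.
Variable gT : finGroupType.
Definition lmul (A : {set gT}) (g : gT) : {set gT} := (g^-1 *: A)%g.

Lemma lmul1 A : lmul A 1%g = A.
Proof. by rewrite /lmul invg1 mul1g. Qed.

Lemma lmulM A : act_morph lmul A.
Proof. by move=> g h; rewrite /lmul invMg lcosetM. Qed.

Definition lmul_action := TotalAction lmul1 lmulM.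

Lemma lmul_acts (H : {set gT}) :
  [acts [set: gT], on lcosets H [set: gT] | lmul_action].
Proof.
apply/actsP=> g _ A; apply/lcosetsP/lcosetsP=> -[x _ defA].
  exists (g * x)%g; rewrite ?inE //.
  by rewrite lcosetM -defA /= /lmul -lcosetM mulgV lcoset1.
by exists (g^-1 * x)%g; rewrite ?inE // lcosetM -defA.
Qed.
End LeftMultiplication.

(* The space F^X with basis X permuted by G: e_x *m perm_repr g = e_(to x g).  *)
Section PermutationModule.
Variables (F : fieldType) (aT : finGroupType) (T : finType).
Variables (to : {action aT &-> T}) (G : {group aT}) (X : {set T}).
Hypothesis actsG : [acts G, on X | to].

Definition perm_rep_mx (g : aT) : 'M[F]_#|X| :=
  \matrix_(i, j) (to (enum_val i) g == enum_val j)%:R.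

Lemma perm_rep_mx_repr : mx_repr G perm_rep_mx.
Proof.
split=> [|g h Gg Gh]; apply/matrixP=> i j; rewrite !mxE.
  by rewrite act1 (inj_eq enum_val_inj).
have Xig : to (enum_val i) g \in X by rewrite (actsP actsG) ?enum_valP.
rewrite (bigD1 (enum_rank_in Xig (to (enum_val i) g))) //= !mxE.
rewrite enum_rankK_in // eqxx mul1r -actM big1 ?addr0 // => k ne_k.
rewrite !mxE [_ == enum_val k]negbTE ?mul0r //.
by apply: contraNneq ne_k => E; apply/eqP/enum_val_inj; rewrite enum_rankK_in.
Qed.

Definition perm_repr := MxRepresentation perm_rep_mx_repr.
End PermutationModule.

Definition is_partition (n : nat) (la : seq nat) :=
  [&& sorted geq la, 0%N \notin la & sumn la == n].

Definition dominates (la mu : seq nat) :=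
  forall k, (sumn (take k mu) <= sumn (take k la))%N.

(* The cells of the Young diagram of la are numbered 0, ..., n - 1 along the   *)
(* rows.  A tableau of shape la is a permutation t, with entry t p in cell p;  *)
(* hence r * t (first r, then t) moves the entries of t by r between cells,    *)
(* while t * g replaces every entry i by g i.                                  *)
Section Specht.
Variables (n : nat) (la : seq nat).

Definition cell_row (p : 'I_n) := reshape_index la p.
Definition cell_col (p : 'I_n) := reshape_offset la p.

Definition row_group : {set 'S_n} :=
  [set r : 'S_n | [forall p, cell_row (r p) == cell_row p]].
Definition col_group : {set 'S_n} :=
  [set c : 'S_n | [forall p, cell_col (c p) == cell_col p]].

(* The tabloid of t is its row-equivalence class.                              *)
Definition tabloid (t : 'S_n) : {set 'S_n} := (row_group :* t)%g.
Definition tabloids : {set {set 'S_n}} := rcosets row_group [set: 'S_n].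

Lemma tabloids_acts : [acts [set: 'S_n], on tabloids | 'Rs].
Proof.
apply/actsP=> g _ A; apply/rcosetsP/rcosetsP=> -[x _ defA].
  exists (x * g^-1)%g; rewrite ?inE //.
  by rewrite rcosetM -defA /= !rcosetE -rcosetM mulgV rcoset1.
by exists (x * g)%g; rewrite ?inE // rcosetM -defA /= rcosetE.
Qed.

Variable F : fieldType.
Let M := perm_repr F (G := [set: 'S_n]%G) tabloids_acts.

(* The sum of sgn(q) {t q} over q in the column group t^-1 C t of t; with      *)
(* q = t^-1 c t this is the sum of sgn(c) {c * t} over c in C.                 *)
Definition polytabloid (t : 'S_n) : 'rV[F]_#|tabloids| :=
  \sum_(c in col_group)
     (-1) ^+ odd_perm c *: \row_j (tabloid (c * t)%g == enum_val j)%:R.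

Definition specht_mx : 'M[F]_#|tabloids| :=
  (\sum_(t : 'S_n) <<polytabloid t>>)%MS.

Lemma polytabloidM t g : polytabloid t *m M g = polytabloid (t * g)%g.
Proof.
rewrite /polytabloid mulmx_suml; apply: eq_bigr => c _.
rewrite -scalemxAl; congr (_ *: _); apply/rowP=> j; rewrite !mxE.
have Tct : tabloid (c * t)%g \in tabloids by apply/rcosetsP; exists (c * t)%g.
rewrite (bigD1 (enum_rank_in Tct (tabloid (c * t)%g))) //= !mxE.
rewrite enum_rankK_in // eqxx mul1r big1 ?addr0 => [|k ne_k].
  by rewrite /tabloid /= rcosetE -rcosetM mulgA.
rewrite !mxE [_ == enum_val k]negbTE ?mul0r //.
by apply: contraNneq ne_k => E; apply/eqP/enum_val_inj; rewrite enum_rankK_in.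
Qed.

Lemma specht_mxmodule : mxmodule M specht_mx.
Proof.
apply/mxmoduleP=> g _; rewrite sumsmxMr; apply/sumsmx_subP=> t _.
rewrite (eqmxMr _ (genmxE _)) polytabloidM.
by rewrite (sumsmx_sup (t * g)%g) // genmxE.
Qed.

Definition specht_repr := submod_repr specht_mxmodule.
End Specht.

Definition specht_char (n : nat) (la : seq nat) : 'CF([set: 'S_n]) :=
  cfRepr (specht_repr n la algC).

Definition multiplicity_free (gT : finGroupType) (G : {group gT})
    (phi : 'CF(G)) :=
  forall i : Iirr G, '[phi, 'chi_i] <= 1.

Definition gelfand_pair (gT : finGroupType) (G H : {group gT}) :=
  H \subset G /\ multiplicity_free ('Ind[G, H] 1).

Definition Lambda (n : nat) (H : {group 'S_n}) (la : seq nat) : Prop :=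
  is_partition n la /\ '['Ind[[set: 'S_n], H] 1, specht_char n la] = 1.

Definition second_largest (P : seq nat -> Prop) (mu : seq nat) :=
  exists top : seq nat,
    [/\ P top, forall nu, P nu -> dominates top nu,
        P mu, mu <> top & forall nu, P nu -> nu <> top -> dominates mu nu].

(* The row group of the row-wise numbered diagram is Sym(la).                  *)
Notation Young_subgroup := row_group.

Section Digraphs.
Variables (T : finType) (Omega : {set T}).

(* x and y may coincide, so a coclique contains no loop.                       *)
Definition coclique (E : {set T * T}) (S : {set T}) :=
  forall x y, x \in S -> y \in S -> (x, y) \notin E.

Definition out_regular (E : {set T * T}) (d : nat) :=
  forall x, x \in Omega -> #|[set y in Omega | (x, y) \in E]| = d.

Definition adjacency (E : {set T * T}) : 'M[algC]_#|Omega| :=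
  \matrix_(i, j) ((enum_val i, enum_val j) \in E)%:R.

Variables (aT : finGroupType) (to : {action aT &-> T}) (G : {set aT}).

Definition is_orbital (E : {set T * T}) :=
  exists x y, [/\ x \in Omega, y \in Omega
                & E = [set (to x g, to y g) | g in G]].
End Digraphs.

Section Eigenvalue.
Variables (n m : nat) (rG : mx_representation algC [set: 'S_n] m).

Definition is_specht_submodule (la : seq nat) (U : 'M[algC]_m) :=
  exists modU : mxmodule rG U,
    mx_rsim (submod_repr modU) (specht_repr n la algC).

(* Vectors are rows, and A acts on functions f by (A f) x = sum_y A x y * f y, *)
(* whence the transpose.                                                       *)
Definition eigenvalue_afforded (A : 'M[algC]_m) (la : seq nat) (a : algC) :=
  (exists U, is_specht_submodule la U) /\
  (forall U, is_specht_submodule la U -> U *m A^T = a *: U).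
End Eigenvalue.

Definition coset_repr (n : nat) (H : {group 'S_n}) :=
  perm_repr algC (G := [set: 'S_n]%G) (lmul_acts H).

(* Main.v *)
(* The [n-1,1]-module consists of the sum-zero vectors of the natural
   permutation module with basis e_1, ..., e_n, so its character is fix(g) - 1,
   and it occurs once in C^Omega exactly when H has two orbits on points.  These
   orbits O correspond to the K-orbits {xH : x n in O} on Omega.  A copy U of the
   [n-1,1]-module in C^Omega contains the image u of sum_i (e_n - e_i).
   This u is fixed by K, hence equal to some a on S and to some b off S, and it
   sums to 0.  The same holds for A u, and A u = d b on S because S is a
   coclique; as a |S| + b (|Omega| - |S|) = 0, this forces A u = theta u for the
   asserted theta, and u generates U. *)
Require Import Defs.
From HB Require Import structures.
From mathcomp Require Import all_boot all_order all_algebra.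
From mathcomp Require Import all_fingroup all_field all_character.
From mathcomp Require Import ring.

Set Implicit Arguments.
Unset Strict Implicit.
Unset Printing Implicit Defensive.

Import GroupScope Order.TTheory GRing.Theory Num.Theory.
Local Open Scope ring_scope.

(** * Tabloids of shape [n-1,1] as points; its Specht module as the sum-zero vectors *)

Section Hook.
Variable m : nat.
Let n := m.+2.
Let la := [:: m.+1; 1%N].

Lemma hook_row (p : 'I_n) : cell_row la p = (p == ord_max) :> nat.
Proof.
rewrite /cell_row /reshape_index /= subSS subn_eq0 subn1 /= -val_eqE /=.
have := ltn_ord p; rewrite /n ltnS leq_eqVlt => /predU1P[->|lt_p].
  by rewrite ltnn subSnn /= eqxx.
by rewrite -ltnS lt_p ltn_eqF.
Qed.

Lemma hook_col (p : 'I_n) : cell_col la p = if p == ord_max then 0%N else p.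
Proof.
rewrite /cell_col /reshape_offset -/(cell_row la p) hook_row.
by case: eqP => [->|_] /=; rewrite ?addn0 ?subnn ?subn0.
Qed.

Lemma hook_row_group (r : 'S_n) :
  (r \in row_group n la) = (r ord_max == ord_max).
Proof.
rewrite inE; apply/forallP/eqP => [/(_ ord_max)|fix_r p].
  by rewrite !hook_row eqxx; case: (r ord_max =P ord_max).
by rewrite !hook_row -{1}fix_r (inj_eq perm_inj).
Qed.

(** The first column consists of the cells [ord0] and [ord_max], and every other column is a single
    cell, so only these two cells can be moved. *)
Lemma hook_col_group : col_group n la = [set 1%g; tperm ord0 ord_max].
Proof.
apply/setP=> c; rewrite !inE; apply/forallP/orP=> [fix_c|].
  have fix_other p : p != ord0 -> p != ord_max -> c p = p.
    move=> p_neq0 p_neqmax; have /eqP := fix_c p.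
    rewrite !hook_col (negPf p_neqmax); case: eqP => [_ p0|_ cp].
      by case/eqP: p_neq0; apply: val_inj.
    exact: val_inj.
  have [c_max|c_max] := eqVneq (c ord_max) ord_max.
    left; apply/eqP/permP=> p; rewrite perm1.
    have [->//|p_neqmax] := eqVneq p ord_max.
    have [-> {p p_neqmax}|/fix_other-> //] := eqVneq p ord0.
    apply/eqP/contraT=> c0; have c0max: c ord0 != ord_max.
      by rewrite -c_max (inj_eq perm_inj).
    by have /perm_inj E := fix_other _ c0 c0max; rewrite E eqxx in c0.
  have cmax0 : c ord_max = ord0.
    apply/eqP/contraT=> c_neq0; have := fix_other _ c_neq0 c_max.
    by move/perm_inj=> E; rewrite E eqxx in c_max.
  right; apply/eqP/permP=> p; case: tpermP => [->|-> //|/eqP p0 /eqP pm].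
    apply/eqP/contraT=> c0max; have c00 : c ord0 != ord0.
      by rewrite -{2}cmax0 (inj_eq perm_inj).
    by have /perm_inj E := fix_other _ c00 c0max; rewrite E eqxx in c00.
  exact: fix_other.
case=> /eqP-> p; rewrite ?perm1 ?eqxx //.
by case: tpermP => [->|->|_ _]; rewrite !hook_col ?eqxx.
Qed.

(* A tabloid of this shape amounts to the entry i alone in its second row. *)
Definition point_tabloid (i : 'I_n) : {set 'S_n} :=
  [set s : 'S_n | s ord_max == i].

Lemma tabloid_hook (t : 'S_n) : tabloid la t = point_tabloid (t ord_max).
Proof.
apply/setP=> s; rewrite mem_rcoset hook_row_group inE permM.
by rewrite -(inj_eq (@perm_inj _ t)) permKV.
Qed.

Lemma point_tabloidE i : point_tabloid i = tabloid la (tperm ord_max i).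
Proof. by rewrite tabloid_hook tpermL. Qed.

Lemma point_tabloid_inj : injective point_tabloid.
Proof.
move=> i j /setP/(_ (tperm ord_max i)); rewrite !inE tpermL eqxx.
by move/esym/eqP.
Qed.

Lemma point_tabloid_in i : point_tabloid i \in tabloids n la.
Proof. by rewrite point_tabloidE; apply/rcosetsP; exists (tperm ord_max i). Qed.

Lemma tabloids_hook : tabloids n la = [set point_tabloid i | i : 'I_n].
Proof.
apply/setP=> A; apply/idP/imsetP => [/rcosetsP[t _ ->]|[i _ ->]].
  by exists (t ord_max); rewrite // -tabloid_hook.
exact: point_tabloid_in.
Qed.

Lemma point_tabloidM i (g : 'S_n) :
  'Rs%act (point_tabloid i) g = point_tabloid (g i).
Proof.
rewrite point_tabloidE /= rcosetE -rcosetM -/(tabloid la _).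
by rewrite tabloid_hook permM tpermL.
Qed.

Definition point_idx (i : 'I_n) : 'I_#|tabloids n la| :=
  enum_rank_in (point_tabloid_in i) (point_tabloid i).

Lemma point_idxK i : enum_val (point_idx i) = point_tabloid i.
Proof. by rewrite enum_rankK_in ?point_tabloid_in. Qed.

Lemma point_idx_inj : injective point_idx.
Proof.
by move=> i j /(congr1 enum_val); rewrite !point_idxK => /point_tabloid_inj.
Qed.

Lemma point_idx_onto j : exists i, j = point_idx i.
Proof.
have /imsetP[i _ Ej]: enum_val j \in [set point_tabloid i | i : 'I_n].
  by rewrite -tabloids_hook enum_valP.
by exists i; apply: enum_val_inj; rewrite point_idxK.
Qed.

Variable F : fieldType.
Let M := perm_repr F (G := [set: 'S_n]%G) (tabloids_acts n la).
Let W := specht_mx n la F.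

Definition point_vec (i : 'I_n) : 'rV[F]_#|tabloids n la| :=
  delta_mx 0 (point_idx i).

(** The column group has only two elements, and its transposition is odd and brings the entry
    [t ord0] into the second row. *)
Lemma polytabloid_hook (t : 'S_n) :
  polytabloid la F t = point_vec (t ord_max) - point_vec (t ord0).
Proof.
rewrite /polytabloid hook_col_group big_setU1 ?big_set1 /=; last first.
  rewrite inE; apply/eqP=> /(congr1 (fun s : 'S_n => s ord0)).
  by rewrite perm1 tpermL => /(congr1 val).
rewrite odd_perm1 odd_tperm expr0 scale1r.
have -> : ord0 != ord_max :> 'I_n by [].
rewrite expr1 scaleN1r; congr (_ - _).
  apply/rowP=> j; have [i ->] := point_idx_onto j.
  rewrite !mxE mul1g tabloid_hook point_idxK (inj_eq point_tabloid_inj).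
  by rewrite (inj_eq point_idx_inj) eq_sym.
apply/rowP=> j; have [i ->] := point_idx_onto j.
rewrite !mxE tabloid_hook permM tpermR point_idxK (inj_eq point_tabloid_inj).
by rewrite (inj_eq point_idx_inj) eq_sym.
Qed.

Lemma point_vecM i g : point_vec i *m M g = point_vec (g i).
Proof.
apply/rowP=> j; have [k ->] := point_idx_onto j.
rewrite -rowE !mxE !point_idxK point_tabloidM (inj_eq point_tabloid_inj).
by rewrite (inj_eq point_idx_inj) eq_sym.
Qed.

Lemma point_vec_mulE p (B : 'M[F]_(_, p)) i j :
  (point_vec i *m B) 0 j = B (point_idx i) j.
Proof. by rewrite -rowE mxE. Qed.

(** Double transitivity of Sym(n): it makes every difference of two distinct basis vectors a
    polytabloid. *)
Lemma perm_two_points i j : i != j -> {t : 'S_n | t ord_max = i & t ord0 = j}.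
Proof.
move=> neq_ij; pose t := tperm ord_max i.
have t_max : t ord_max = i by rewrite tpermL.
have t0_neq : t ord0 != i by rewrite -t_max (inj_eq perm_inj).
exists (t * tperm (t ord0) j)%g; last by rewrite permM tpermL.
by rewrite permM t_max tpermD // eq_sym.
Qed.

Lemma point_vec_sub i j : (point_vec i - point_vec j <= W)%MS.
Proof.
have [->|/perm_two_points[t <- <-]] := eqVneq i j.
  by rewrite subrr sub0mx.
by rewrite -polytabloid_hook (sumsmx_sup t) // genmxE.
Qed.

Lemma specht_hook_subP p (B : 'M[F]_(p, _)) :
  (forall i j, (point_vec i - point_vec j <= B)%MS) -> (W <= B)%MS.
Proof.
by move=> sB; apply/sumsmx_subP=> t _; rewrite genmxE polytabloid_hook.
Qed.

(** The kernel of [A - B] is a subspace, and the differences of basis vectors span the Specht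
    module. *)
Lemma specht_hook_mul_eq p (A B : 'M[F]_(_, p)) :
  (forall i j,
    (point_vec i - point_vec j) *m A = (point_vec i - point_vec j) *m B) ->
  W *m A = W *m B.
Proof.
move=> eqAB; apply/eqP; rewrite -subr_eq0 -mulmxBr.
rewrite -sub_kermx; apply: specht_hook_subP => i j.
by rewrite sub_kermx mulmxBr eqAB subrr.
Qed.

Lemma row_point_vec p (v : 'M[F]_(p, #|tabloids n la|)) :
  exists c : 'M[F]_(p, n), v = c *m \matrix_i point_vec i.
Proof.
exists (\matrix_(a, i) v a (point_idx i)).
apply/matrixP=> a j; rewrite mxE; have [i ->] := point_idx_onto j.
rewrite (bigD1 i) //= !mxE !eqxx mulr1 big1 ?addr0 // => k ne_k.
by rewrite !mxE (inj_eq point_idx_inj) eq_sym (negPf ne_k) mulr0.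
Qed.

(* G acts trivially on the quotient by the Specht module. *)
Lemma specht_hook_quotient p (v : 'M[F]_(p, #|tabloids n la|)) g :
  (v *m M g - v <= W)%MS.
Proof.
have [c ->] := row_point_vec v.
rewrite -mulmxA -mulmxBr (submx_trans (submxMl _ _)) //.
apply/row_subP=> i; rewrite linearB /= row_mul rowK point_vecM.
exact: point_vec_sub.
Qed.

Lemma point_vec_sum i : point_vec i *m const_mx 1 = 1 :> 'M_1.
Proof.
by rewrite -rowE; apply/matrixP=> a b; rewrite !ord1 !mxE eqxx.
Qed.

Lemma specht_hook_sum0 : W *m const_mx 1 = 0 :> 'cV_#|tabloids n la|.
Proof.
rewrite -(mulmx0 _ W); apply: specht_hook_mul_eq => i j.
by rewrite mulmx0 mulmxBl !point_vec_sum subrr.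
Qed.

Lemma card_tabloids_hook : #|tabloids n la| = n.
Proof.
by rewrite tabloids_hook card_imset ?card_ord //; apply: point_tabloid_inj.
Qed.

(** Upper bound: [W] lies in the hyperplane of sum-zero vectors. Lower bound: [W] and a single basis
    vector span the whole space. *)
Lemma rank_specht_hook : \rank W = m.+1.
Proof.
apply/anti_leq/andP; split.
  pose c : 'cV[F]_#|tabloids n la| := const_mx 1.
  have c_gt0 : (0 < \rank c)%N.
    rewrite lt0n mxrank_eq0; apply/eqP=> c0.
    have /eqP := congr1 (mulmx (point_vec ord0)) c0.
    by rewrite point_vec_sum mulmx0 oner_eq0.
  have: (W <= kermx c)%MS by rewrite sub_kermx specht_hook_sum0.
  move/mxrankS/leq_trans; apply; rewrite mxrank_ker leq_subLR.
  apply: leq_trans (leq_add c_gt0 (leqnn _)).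
  by rewrite card_tabloids_hook.
have: (1%:M <= W + point_vec ord0)%MS.
  have [c ->] := row_point_vec 1%:M; rewrite (submx_trans (submxMl _ _)) //.
  apply/row_subP=> i; rewrite rowK -(subrK (point_vec ord0) (point_vec i)).
  exact: addmx_sub_adds (point_vec_sub _ _) (submx_refl _).
move/mxrankS; rewrite mxrank1.
move=> /leq_trans/(_ (mxrank_adds_leqif _ _)) le_card.
have := leq_trans le_card (leq_add (leqnn _) (rank_leq_row (point_vec ord0))).
by move/(leq_trans (eq_leq (esym card_tabloids_hook))); rewrite addn1.
Qed.

Lemma trace_perm_hook g : \tr (M g) = #|[set i : 'I_n | g i == i]|%:R :> F.
Proof.
rewrite /mxtrace -sum1dep_card natr_sum.
transitivity (\sum_(j < #|tabloids n la|)
    ('Rs%act (enum_val j) g == enum_val j)%:R : F).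
  by apply: eq_bigr => j _; rewrite mxE.
rewrite -(big_enum_val (fun A : {set 'S_n} => ('Rs%act A g == A)%:R)) /=.
rewrite tabloids_hook big_imset /=; last exact: in2W point_tabloid_inj.
rewrite [RHS]big_mkcond; apply: eq_bigr => i _.
rewrite -[rcoset _ _]/('Rs%act _ g) point_tabloidM (inj_eq point_tabloid_inj).
by case: eqP.
Qed.

(** The quotient by the Specht module is one-dimensional with trivial action, so it takes 1 from the
    trace of the permutation module. *)
Lemma trace_specht_hook g :
  \tr (specht_repr n la F g) = #|[set i : 'I_n | g i == i]|%:R - 1.
Proof.
rewrite -trace_perm_hook -(mxtrace_sub_fact_mod (specht_mxmodule n la F) g).
suff -> : \tr (factmod_repr (specht_mxmodule n la F) g) = 1 by rewrite addrK.
have -> : factmod_repr (specht_mxmodule n la F) g = 1%:M.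
  apply/eqP; rewrite -subr_eq0 /= /factmod_mx.
  rewrite -[1%:M in X in _ - X]val_factmodK.
  by rewrite -linearB /= in_factmod_eq0 specht_hook_quotient.
by rewrite mxtrace1 mxrank_coker rank_specht_hook card_tabloids_hook /n subSnn.
Qed.

End Hook.

(** * Entries of permutation representations; invariance of orbitals *)

Section PermReprTheory.
Variables (F : fieldType) (aT : finGroupType) (T : finType).
Variables (to : {action aT &-> T}) (G : {group aT}) (X : {set T}).
Hypothesis actsG : [acts G, on X | to].
Let V := perm_repr F actsG.

Lemma mulmx_perm_repr p (B : 'M[F]_(p, #|X|)) g a i j :
  enum_val j = to (enum_val i) g -> (B *m V g) a j = B a i.
Proof.
move=> Ej; rewrite mxE (bigD1 i) //= mxE Ej eqxx mulr1 big1 ?addr0 // => k ne_k.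
rewrite mxE Ej (inj_eq (act_inj to g)) (inj_eq enum_val_inj).
by rewrite (negPf ne_k) mulr0.
Qed.

Lemma perm_repr_mulmx p (B : 'M[F]_(#|X|, p)) g a i j :
  enum_val j = to (enum_val i) g -> (V g *m B) i a = B j a.
Proof.
move=> Ej; rewrite mxE (bigD1 j) //= mxE Ej eqxx mul1r big1 ?addr0 // => k ne_k.
by rewrite mxE -Ej (inj_eq enum_val_inj) eq_sym (negPf ne_k) mul0r.
Qed.

Lemma enum_val_act g (i : 'I_#|X|) : g \in G ->
  exists j : 'I_#|X|, enum_val j = to (enum_val i) g.
Proof.
move=> Gg; have Xi : to (enum_val i) g \in X.
  by rewrite (actsP actsG) ?enum_valP.
by exists (enum_rank_in Xi (to (enum_val i) g)); rewrite enum_rankK_in.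
Qed.

Lemma perm_repr_const g : g \in G -> V g *m const_mx 1 = const_mx 1 :> 'cV_#|X|.
Proof.
move=> Gg; apply/colP=> i; have [j Ej] := enum_val_act i Gg.
by rewrite (perm_repr_mulmx _ _ Ej) !mxE.
Qed.

End PermReprTheory.

Lemma is_orbitalJ (T : finType) (Omega : {set T}) (aT : finGroupType)
    (to : {action aT &-> T}) (G : {group aT}) E g x y :
  is_orbital Omega to G E -> g \in G ->
  ((to x g, to y g) \in E) = ((x, y) \in E).
Proof.
move=> [x0 [y0 [_ _ ->]]] Gg; apply/imsetP/imsetP => -[h Gh [Ex Ey]].
  by exists (h * g^-1)%g; rewrite ?groupM ?groupV // !actM -Ex -Ey !actK.
by exists (h * g)%g; rewrite ?groupM // !actM -Ex -Ey.
Qed.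

(** At entry (i, k) the two sides test whether the pairs (k, i g) and (k g^-1, i) are arcs, and [g]
    carries the second pair to the first. *)
Lemma adjacency_perm_repr (aT : finGroupType) (T : finType)
    (to : {action aT &-> T}) (G : {group aT}) (X : {set T})
    (actsG : [acts G, on X | to]) (E : {set T * T}) g :
  (forall x y, ((to x g, to y g) \in E) = ((x, y) \in E)) -> g \in G ->
  perm_repr algC actsG g *m (adjacency X E)^T =
    (adjacency X E)^T *m perm_repr algC actsG g.
Proof.
move=> invE Gg; apply/matrixP=> i k; have [j Ej] := enum_val_act actsG i Gg.
have [l El] := enum_val_act actsG k (groupVr Gg).
have Ek : enum_val k = to (enum_val l) g by rewrite El actKV.
rewrite (perm_repr_mulmx actsG _ _ Ej) (mulmx_perm_repr actsG _ _ Ek) !mxE.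
by rewrite Ej Ek invE.
Qed.

(** * The eigenvector equation for vectors with one value on a coclique and one off it *)

Section Coclique.
Variables (T : finType) (Omega S : {set T}) (E : {set T * T}) (d : nat).
Hypotheses (sSO : S \proper Omega) (S_neq0 : S != set0).

Definition constant_on_split (u : 'rV[algC]_#|Omega|) :=
  forall i j, (enum_val i \in S) = (enum_val j \in S) -> u 0 i = u 0 j.

Lemma sum_constant_on_split u s r : constant_on_split u ->
    enum_val s \in S -> enum_val r \notin S -> u *m const_mx 1 = 0 :> 'M_1 ->
  u 0 s * #|S|%:R + u 0 r * (#|Omega|%:R - #|S|%:R) = 0.
Proof.
move=> u_const Ss Sr /matrixP/(_ 0 0); rewrite !mxE => <-.
have -> : #|Omega|%:R - #|S|%:R = #|Omega :\: S|%:R :> algC.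
  by rewrite cardsDS ?natrB ?subset_leq_card ?proper_sub.
under [RHS]eq_bigr => i _ do rewrite mxE mulr1.
transitivity (\sum_(x in Omega) if x \in S then u 0 s else u 0 r); last first.
  rewrite big_enum_val; apply: eq_bigr => i _.
  case: ifPn => Si; apply: u_const; rewrite ?Ss ?Si //.
  by rewrite (negPf Sr) (negPf Si).
rewrite (big_setID S) /= (setIidPr (proper_sub sSO)).
rewrite (eq_bigr (fun=> u 0 s)) => [|x ->//].
rewrite [X in _ = _ + X](eq_bigr (fun=> u 0 r)) => [|x]; last first.
  by rewrite inE => /andP[/negPf->].
by rewrite !sumr_const !mulr_natr.
Qed.

(** Sum-zero vectors constant on [S] and on its complement form a line, so the image of [u] is a
    multiple of [u]; the factor is read off from one vertex in [S]. *)
Lemma coclique_eigenvector (u : 'rV[algC]_#|Omega|) :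
    coclique E S -> out_regular Omega E d ->
    constant_on_split u -> constant_on_split (u *m (adjacency Omega E)^T) ->
    u *m const_mx 1 = 0 :> 'M_1 ->
    u *m (adjacency Omega E)^T *m const_mx 1 = 0 :> 'M_1 ->
  u *m (adjacency Omega E)^T =
    (- (d%:R * #|S|%:R / (#|Omega|%:R - #|S|%:R))) *: u.
Proof.
move=> cocl outd u_const Au_const u_sum0 Au_sum0; set A := adjacency _ _.
have /andP[sub_SO /subsetPn[y Oy Sy]] := sSO; have [x Sx] := set0Pn _ S_neq0.
have Ox := subsetP sub_SO x Sx.
pose s := enum_rank_in Ox x; pose r := enum_rank_in Oy y.
have Ss : enum_val s \in S by rewrite enum_rankK_in.
have Sr : enum_val r \notin S by rewrite enum_rankK_in.
(* All [d] out-neighbours of [s] lie outside [S], where [u] has the value [u 0 r]. *)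
have Au_s : (u *m A^T) 0 s = d%:R * u 0 r.
  have OS := enum_valP s; rewrite -(outd _ OS) -sum1dep_card natr_sum mulr_suml.
  rewrite big_mkcondr big_enum_val mxE; apply: eq_bigr => i _; rewrite !mxE.
  case: ifP => [Esi|_]; rewrite ?mulr0 // mul1r mulr1; apply: u_const.
  rewrite (negPf Sr); apply: contraTF Esi => Si; exact: cocl.
have := sum_constant_on_split u_const Ss Sr u_sum0.
have := sum_constant_on_split Au_const Ss Sr Au_sum0; rewrite Au_s.
have : #|Omega|%:R - #|S|%:R != 0 :> algC.
  by rewrite subr_eq0 eqr_nat gtn_eqF // proper_card.
move: (_ - _) => L L_neq0 Au_eq u_eq.
(* The value [b] off [S] is determined by the value [a] on [S]; this applies to [u] and to its
   image. *)
have solve a b : a * #|S|%:R + b * L = 0 -> b = - (#|S|%:R / L) * a.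
  move=> /eqP; rewrite addrC addr_eq0 => /eqP bL.
  by apply: (mulIf L_neq0); rewrite bL; field.
have u_r := solve _ _ u_eq; have Au_r := solve _ _ Au_eq.
apply/rowP=> i; rewrite [RHS]mxE; have [Si|Si] := boolP (enum_val i \in S).
  rewrite (Au_const i s) ?(u_const i s) ?Ss ?Si // Au_s u_r.
  by field.
rewrite (Au_const i r) ?(u_const i r) ?(negPf Sr) ?(negPf Si) // Au_r.
by field.
Qed.
End Coclique.

(** * Orbits of [H] on points and of the point stabiliser on cosets *)

Section PointOrbits.
Variables (m : nat) (H : {group 'S_m.+2}).
Let n := m.+2.
Let la := [:: m.+1; 1%N].
Let Omega := lcosets H [set: 'S_n].

(** By Frobenius reciprocity the multiplicity 1 is the average of fix(h) - 1 over [H], which by the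
    Cauchy-Frobenius formula is the number of orbits minus 1. *)
Lemma Lambda_two_orbits :
  Lambda H la -> #|[set orbit 'P H i | i in [set: 'I_n]]| = 2.
Proof.
case=> _; rewrite -Frobenius_reciprocity cfdotE.
rewrite (eq_bigr
    (fun h : 'S_n => #|'Fix_([set: 'I_n] | 'P)[h]|%:R - 1)) => [|h Hh].
  rewrite sumrB -natr_sum Frobenius_Cauchy ?sumr_const; last first.
    by apply/actsP=> h _ i; rewrite !inE.
  rewrite mulrBr mulVf ?neq0CG // natrM mulrC mulfK ?neq0CG //.
  by move/eqP; rewrite subr_eq -(natrD _ 1 1) eqr_nat => /eqP.
rewrite cfun1E Hh mul1r cfResE ?subsetT // /specht_char cfunE inE mulr1n.
rewrite trace_specht_hook rmorphB rmorph1 /= rmorph_nat.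
congr (_%:R - 1); apply: eq_card => i; by rewrite !inE sub1set inE.
Qed.

(* On a left coset xH this is the H-orbit of x i; it identifies the orbits on
   Omega of the stabiliser of i with the orbits of H on points. *)
Definition evals (C : {set 'S_n}) (i : 'I_n) : {set 'I_n} :=
  [set (x : 'S_n) i | x in C].

(** Permutations are composed left factor first, so the elements [x * h] of the coset send [i] to
    [h (x i)]. *)
Lemma evals_lcoset x i : evals (x *: H)%g i = orbit 'P H (x i).
Proof.
apply/setP=> j; apply/imsetP/orbitP => [[y /lcosetP[h Hh ->] ->]|[h Hh <-]].
  by exists h; rewrite // permM.
by exists (x * h)%g; rewrite ?permM // mem_lcoset mulKg.
Qed.

Lemma evals_lmul C i g : evals (lmul C g) (g i) = evals C i.
Proof.
apply/setP=> j; apply/imsetP/imsetP => [[y]|[y Cy ->]].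
  rewrite mem_lcoset invgK => Cy ->; exists (g * y)%g => //; by rewrite permM.
exists (g^-1 * y)%g; rewrite ?permM ?permK //.
by rewrite mem_lcoset invgK mulKVg.
Qed.

Lemma evals_transitive C D i : C \in Omega -> D \in Omega ->
  evals C i = evals D i -> exists2 k : 'S_n, k i = i & D = lmul C k.
Proof.
move=> /lcosetsP[x _ ->] /lcosetsP[y _ ->]; rewrite !evals_lcoset => Exy.
have: y i \in orbit 'P H (x i) by rewrite Exy orbit_refl.
(* As [h] sends [x i] to [y i], this product fixes [i]; its inverse times xH is y h^-1 H = yH. *)
case/orbitP=> h Hh Ey; exists ((x * h) * y^-1)%g.
  by rewrite !permM -[h _]/(aperm (x i) h) Ey permK.
rewrite /lmul invMg invgK -lcosetM -mulgA invMg mulgKV.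
by rewrite lcosetM (lcoset_id (groupVr Hh)).
Qed.

(** [row_group] is the stabiliser of [ord_max]. It preserves [evals C ord_max] by [evals_lmul] and
    is transitive on the cosets sharing this value by [evals_transitive]. *)
Lemma orbit_evals (S : {set {set 'S_n}}) :
    S \in orbit (lmul_action 'S_n) (row_group n la) @: Omega ->
  exists2 C0, C0 \in Omega &
    forall C, C \in Omega -> (C \in S) = (evals C ord_max == evals C0 ord_max).
Proof.
case/imsetP=> C0 OC0 ->; exists C0 => // C OC.
apply/orbitP/eqP => [[k]|/esym/(evals_transitive OC0 OC)[k fix_k ->]].
  by rewrite hook_row_group => /eqP fix_k <-; rewrite -{1}fix_k evals_lmul.
by exists k; rewrite // hook_row_group fix_k.
Qed.

End PointOrbits.

(** * Equivariant images of the Specht module and its vector fixed by K *)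

Section SpechtImages.
Variable m : nat.
Let n := m.+2.
Let la := [:: m.+1; 1%N].
Let M := perm_repr algC (G := [set: 'S_n]%G) (tabloids_acts n la).
Let W := specht_mx n la algC.
Let e := @point_vec m algC.

Definition stable_vec : 'rV[algC]_#|tabloids n la| :=
  \sum_i (e ord_max - e i).

Lemma stable_vec_sub : (stable_vec <= W)%MS.
Proof. by apply: summx_sub => i _; apply: point_vec_sub. Qed.

Lemma stable_vecM g : stable_vec *m M g = \sum_i (e (g ord_max) - e i).
Proof.
rewrite mulmx_suml !sumrB; under eq_bigr do rewrite mulmxBl !point_vecM.
by rewrite sumrB; congr (_ - _); rewrite [RHS](reindex_inj (@perm_inj _ g)).
Qed.

(** Each translate of [stable_vec] is n times a basis vector minus the all-one vector, which cancels
    in the difference. Hence the translates span the Specht module. *)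
Lemma stable_vec_diff i j : e i - e j =
  n%:R^-1 *:
    (stable_vec *m M (tperm ord_max i) - stable_vec *m M (tperm ord_max j)).
Proof.
rewrite !stable_vecM !tpermL -sumrB.
under eq_bigr do rewrite opprB addrA subrK.
by rewrite sumr_const card_ord -scaler_nat scalerA mulVf ?scale1r ?pnatr_eq0.
Qed.

Variables (p : nat) (rG : mx_representation algC [set: 'S_n] p).
Variable D : 'M[algC]_(#|tabloids n la|, p).
(** Equivariance is asked on [W] only, because an embedding of [W] will be extended to the ambient
    space by a merely linear projection. *)
Hypothesis homD : forall q (v : 'M_(q, _)) g,
  (v <= W)%MS -> v *m M g *m D = v *m D *m rG g.

(* Exchanging i and j negates e i - e j but preserves invariant functionals. *)
Lemma invariant_functional0 (f : 'cV[algC]_p) q (v : 'M_(q, _)) :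
  (forall g, rG g *m f = f) -> (v <= W)%MS -> v *m D *m f = 0.
Proof.
move=> inv_f /submxP[c ->]; rewrite -!mulmxA.
suff -> : W *m (D *m f) = 0 by rewrite mulmx0.
rewrite -(mulmx0 _ W); apply: specht_hook_mul_eq => i j.
rewrite mulmx0 -/(e _) -/(e _).
have := homD (tperm i j) (@point_vec_sub m algC i j).
rewrite mulmxBl !point_vecM tpermL tpermR -(opprB (e i)).
move=> /(congr1 (mulmx^~ f)).
rewrite -[RHS]mulmxA inv_f !mulNmx -!mulmxA => /eqP.
rewrite eq_sym -addr_eq0 -mulr2n -scaler_nat scaler_eq0 pnatr_eq0 /=.
by move/eqP.
Qed.

(** The equation passes to all translates of [stable_vec] because [A] commutes with the group, and
    these span [W]. *)
Lemma stable_vec_eigen (A : 'M[algC]_p) a :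
    (forall g, rG g *m A = A *m rG g) ->
    stable_vec *m D *m A = a *: (stable_vec *m D) ->
  W *m D *m A = a *: (W *m D).
Proof.
move=> commA eig.
have eigM g : stable_vec *m M g *m D *m A = a *: (stable_vec *m M g *m D).
  rewrite homD ?stable_vec_sub // -[LHS]mulmxA commA mulmxA eig.
  by rewrite -scalemxAl.
rewrite -mulmxA [in RHS]scalemxAr.
apply: specht_hook_mul_eq => i j; rewrite -/(e _) -/(e _) stable_vec_diff.
rewrite -scalemxAl -[RHS]scalemxAl; congr (_ *: _); rewrite mulmxA -scalemxAr.
have := eigM (tperm ord_max j); have := eigM (tperm ord_max i).
move: (_ *m M _) (_ *m M _) => x y Ex Ey.
by rewrite !mulmxBl scalerBr Ex Ey.
Qed.

End SpechtImages.

(** * Submodules isomorphic to the Specht module as images of matrices *)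

Section SpechtSubmodules.
Variables (m p : nat) (rG : mx_representation algC [set: 'S_m.+2] p).
Let n := m.+2.
Let la := [:: m.+1; 1%N].
Let M := perm_repr algC (G := [set: 'S_n]%G) (tabloids_acts n la).
Let W := specht_mx n la algC.

(** Turns an abstract isomorphism into one matrix on ambient coordinates: take coordinates in [W],
    apply the isomorphism, and include [U] in the ambient space. *)
Lemma specht_submodule_image U : is_specht_submodule rG la U ->
  exists2 D : 'M[algC]_(_, p),
    (U <= W *m D)%MS &
    forall q (v : 'M_(q, _)) g, (v <= W)%MS -> v *m M g *m D = v *m D *m rG g.
Proof.
case=> modU /mx_rsim_sym[B eq_rk B_free homB].
pose D := in_submod W 1%:M *m B *m val_submod 1%:M.
have DE q (v : 'M_(q, _)) : v *m D = val_submod (in_submod W v *m B).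
  by rewrite [in RHS]val_submodE (in_submodE _ v) /D !mulmxA.
(* [B] is square, so being free it also has a left inverse, which expresses the basis of [U] through
   [W *m D]. *)
have /row_fullP[C CB] : row_full B.
  by move: B_free; rewrite /row_free /row_full => /eqP->; apply/eqP.
exists D => [|q v g sub_v].
  rewrite -(val_submod1 U) -CB (_ : val_submod _ = C *m val_submod 1%:M *m D).
    by rewrite submxMr // (submx_trans (submxMl _ _)) // val_submod1.
  rewrite -mulmxA DE val_submodK mul1mx [LHS]val_submodE.
  by rewrite -mulmxA -val_submodE.
rewrite !DE (in_submodJ (specht_mxmodule n la algC)) // -mulmxA.
have /= -> := homB g (in_setT g).
by rewrite mulmxA (val_submodJ modU) ?inE.
Qed.

Lemma specht_submodule_of_hom (D : 'M[algC]_(_, p)) :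
    (forall g, M g *m D = D *m rG g) ->
    (forall v : 'rV_#|tabloids n la|, (v <= W)%MS -> v *m D = 0 -> v = 0) ->
  is_specht_submodule rG la <<W *m D>>%MS.
Proof.
move=> homD injD; set U := <<_>>%MS.
have modU : mxmodule rG U.
  apply/mxmoduleP=> g Gg; rewrite (eqmxMr _ (genmxE _)) -mulmxA -homD mulmxA.
  rewrite genmxE submxMr //.
  exact: (mxmoduleP (specht_mxmodule n la algC)).
have rankU : \rank U = \rank W.
  rewrite genmxE; apply/mxrank_injP/rowV0P=> v.
  by rewrite sub_capmx => /andP[sub_v /sub_kermxP]; apply: injD.
have sub_valD : (val_submod (1%:M : 'M_(\rank W)) *m D <= U)%MS.
  by rewrite /U genmxE submxMr // val_submod1.
exists modU; apply: mx_rsim_sym.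
(* The restriction of [D] to [W], in the chosen bases of [W] and [U]; it is invertible because
   injectivity gave equal ranks. *)
apply: (MxReprSim (B := in_submod U (val_submod 1%:M *m D))) => // [|g Gg].
  rewrite /row_free mxrank_in_submod // (eqmxMr D (val_submod1 W)).
  by apply/eqP; rewrite -[RHS]rankU /U genmxE.
rewrite -(in_submodJ modU) // -[in RHS]mulmxA -homD [in RHS]mulmxA.
rewrite -(val_submodJ (specht_mxmodule n la algC)) // mul1mx.
by rewrite [in RHS]val_submodE [in RHS]in_submodE [in LHS]in_submodE !mulmxA.
Qed.

(* A nonzero v in the kernel has v_i != v_j for some i and j, so that v minus
   its image under (i j) puts e i - e j, and by 2-transitivity W, in the
   kernel. *)
Lemma specht_hom_inj (D : 'M[algC]_(_, p)) (v : 'rV_#|tabloids n la|) :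
    (forall g, M g *m D = D *m rG g) -> W *m D != 0 ->
  (v <= W)%MS -> v *m D = 0 -> v = 0.
Proof.
move=> homD WD_neq0 sub_v vD0.
have e0_neq0 : (point_vec algC ord_max - point_vec algC ord0) *m D != 0.
  apply: contraNneq WD_neq0 => eD0; rewrite -(mulmx0 _ W); apply/eqP.
  apply: specht_hook_mul_eq => i j; rewrite mulmx0.
  have [->|/perm_two_points[t <- <-]] := eqVneq i j.
    by rewrite subrr mul0mx.
  by rewrite -!point_vecM -mulmxBl -mulmxA homD mulmxA eD0 mul0mx.
have v_const i j : v 0 (point_idx i) = v 0 (point_idx j).
  have [->//|neq_ij] := eqVneq i j; apply/eqP; apply: contraNT e0_neq0 => neq_v.
  have [t ti tj] := perm_two_points neq_ij.
  have E : v *m M (tperm i j) - v =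
      (v 0 (point_idx i) - v 0 (point_idx j)) *:
        (point_vec algC j - point_vec algC i).
    apply/rowP=> a; have [k ->] := point_idx_onto a.
    have Ek : enum_val (point_idx k) =
        'Rs%act (enum_val (point_idx (tperm i j k))) (tperm i j).
      by rewrite !point_idxK point_tabloidM tpermK.
    rewrite mxE (mulmx_perm_repr (tabloids_acts n la) _ _ Ek) !mxE.
    rewrite !(inj_eq (@point_idx_inj m)) /=.
    case: tpermP => [->|->|/eqP/negPf-> /eqP/negPf->].
    3: by rewrite !subrr mulr0.
      by rewrite eqxx (negPf neq_ij) sub0r mulrN1 opprB.
    by rewrite eqxx eq_sym (negPf neq_ij) subr0 mulr1.
  have: (v *m M (tperm i j) - v) *m D = 0.
    by rewrite mulmxBl vD0 subr0 -mulmxA homD mulmxA vD0 mul0mx.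
  rewrite E -scalemxAl => /eqP; rewrite scaler_eq0 subr_eq0 (negPf neq_v) /=.
  rewrite -opprB mulNmx oppr_eq0 -ti -tj -!point_vecM -mulmxBl => /eqP eD.
  rewrite -(mulmx1 (point_vec algC _ - point_vec algC _)) -(repr_mx1 M).
  rewrite -(mulgV t) repr_mxM ?inE //.
  by rewrite mulmxA -(mulmxA _ _ D) homD mulmxA eD mul0mx.
(* A constant vector whose coordinates sum to 0 vanishes in characteristic 0. *)
have : v *m const_mx 1 = 0 :> 'M_1.
  by have /submxP[c ->] := sub_v; rewrite -mulmxA specht_hook_sum0 mulmx0.
move=> /matrixP/(_ 0 0); rewrite !mxE.
rewrite (eq_bigr (fun=> v 0 (point_idx ord0))) => [|a _]; last first.
  by have [k ->] := point_idx_onto a; rewrite mxE mulr1; apply: v_const.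
have card_neq0 : (#|tabloids n la| == 0)%N = false.
  by rewrite card_tabloids_hook.
rewrite sumr_const card_ord => /eqP; rewrite mulrn_eq0 card_neq0 => /eqP v0.
apply/rowP=> a.
by have [k ->] := point_idx_onto a; rewrite mxE -v0; apply: v_const.
Qed.

End SpechtSubmodules.

(** * The permutation module on cosets when [H] has two orbits on points *)

Section CosetModule.
Variables (m : nat) (H : {group 'S_m.+2}).
Let n := m.+2.
Let la := [:: m.+1; 1%N].
Let Omega := lcosets H [set: 'S_n].
Let orbits := [set orbit 'P H i | i in [set: 'I_n]].
Let M := perm_repr algC (G := [set: 'S_n]%G) (tabloids_acts n la).
Let W := specht_mx n la algC.

(** Sends [e_i] to the indicator of the cosets xH with x i in [O], for [O] an orbit. All
    permutations in the tabloid of [i] send [ord_max] to [i], so any representative recovers [i]. *)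
Definition orbit_incidence (O : {set 'I_n}) :
    'M[algC]_(#|tabloids n la|, #|Omega|) :=
  \matrix_(a, b)
    (evals (enum_val b) ((repr (enum_val a) : 'S_n) ord_max) == O)%:R.

Lemma orbit_incidenceE O i b :
  orbit_incidence O (point_idx i) b = (evals (enum_val b) i == O)%:R.
Proof.
rewrite mxE point_idxK; have: tperm ord_max i \in point_tabloid i.
  by rewrite inE tpermL.
by move/mem_repr; rewrite inE => /eqP->.
Qed.

Lemma orbit_incidence_hom O g :
  M g *m orbit_incidence O = orbit_incidence O *m coset_repr H g.
Proof.
apply/matrixP=> a b; have [i ->] := point_idx_onto a.
have [c Ec] := enum_val_act (lmul_acts H) b (groupVr (in_setT g)).
have Eb : enum_val b = lmul_action 'S_n (enum_val c) g by rewrite Ec actKV.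
have Ei : enum_val (point_idx (g i)) = 'Rs%act (enum_val (point_idx i)) g.
  by rewrite !point_idxK point_tabloidM.
rewrite (perm_repr_mulmx (tabloids_acts n la) _ _ Ei).
rewrite (mulmx_perm_repr (lmul_acts H) _ _ Eb).
by rewrite !orbit_incidenceE Eb evals_lmul.
Qed.

Hypothesis two_orbits : #|orbits| = 2.

Lemma exists_specht_submodule :
  exists U, is_specht_submodule (coset_repr H) la U.
Proof.
have /eqP/cards2P[O1 [O2 [neqO defO]]] := two_orbits.
have /imsetP[i _ EO1] : O1 \in orbits.
  by rewrite defO !inE eqxx.
have /imsetP[j _ EO2] : O2 \in orbits.
  by rewrite defO !inE eqxx orbT.
exists <<W *m orbit_incidence O1>>%MS; apply: specht_submodule_of_hom.
  exact: orbit_incidence_hom.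
move=> v; apply: specht_hom_inj; first exact: orbit_incidence_hom.
apply/eqP=> WD0; have OH : (H : {set 'S_n}) \in Omega.
  by apply/lcosetsP; exists 1%g; rewrite ?inE ?mul1g.
have : point_vec algC i *m orbit_incidence O1 =
    point_vec algC j *m orbit_incidence O1.
  apply/eqP; rewrite -subr_eq0 -mulmxBl.
  by have /submxP[c ->] := point_vec_sub algC i j; rewrite -mulmxA WD0 mulmx0.
(* At the coset [H] itself the two images have entries 1 and 0, since [i] lies in [O1] and [j] in
   [O2]. *)
move/rowP/(_ (enum_rank_in OH (H : {set _}))).
rewrite !point_vec_mulE !orbit_incidenceE enum_rankK_in // -[gval H]lcoset1.
rewrite !evals_lcoset !perm1 -EO1 -EO2 eqxx eq_sym (negPf neqO).
by move/eqP; rewrite oner_eq0.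
Qed.

Lemma evals_orbits C i : C \in Omega -> evals C i \in orbits.
Proof. by case/lcosetsP=> x _ ->; rewrite evals_lcoset imset_f. Qed.

Lemma two_orbits_split (O A B : {set 'I_n}) :
    O \in orbits ->
    A \in orbits ->
    B \in orbits ->
  (A == O) = (B == O) -> A = B.
Proof.
have /eqP/cards2P[O1 [O2 [neqO ->]]] := two_orbits.
rewrite !inE => /orP[]/eqP-> /orP[]/eqP-> /orP[]/eqP->//;
  by rewrite eqxx ?[O2 == _]eq_sym (negPf neqO).
Qed.

Variable S : {set {set 'S_n}}.
Hypothesis orbitS : S \in orbit (lmul_action 'S_n) (row_group n la) @: Omega.

Lemma point_orbit_neq0 : S != set0.
Proof.
have [C0 OC0 SE] := orbit_evals orbitS.
by apply/set0Pn; exists C0; rewrite SE.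
Qed.

Lemma point_orbit_proper : S \proper Omega.
Proof.
have [C0 OC0 SE] := orbit_evals orbitS; apply/properP; split.
  have /imsetP[C OC ->] := orbitS; apply/subsetP=> _ /imsetP[k _ ->].
  by rewrite (actsP (lmul_acts H)) ?inE.
have /subsetPn[O' /imsetP[k _ EO'] neqO'] :
    ~~ (orbits \subset [set evals C0 ord_max]).
  by apply/negP=> /subset_leq_card; rewrite two_orbits cards1.
(* The transposition takes [ord_max] to the point [k] of another orbit, so its coset lies outside
   [S]. *)
have OC : (tperm ord_max k *: H)%g \in Omega.
  by apply/lcosetsP; exists (tperm ord_max k).
exists (tperm ord_max k *: H)%g => //; rewrite SE // evals_lcoset tpermL -EO'.
by rewrite inE in neqO'.
Qed.

(** With only two orbits, cosets on the same side of [S] have equal [evals] at [ord_max], so an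
    element of K carries one to the other. *)
Lemma fixed_constant_on_split (u : 'rV[algC]_#|Omega|) :
    (forall k : 'S_n, k ord_max = ord_max -> u *m coset_repr H k = u) ->
  constant_on_split S u.
Proof.
move=> fix_u i j; have [C0 OC0 SE] := orbit_evals orbitS.
rewrite !SE ?enum_valP // => E.
have [|k fix_k Ej] :=
    evals_transitive (i := ord_max) (enum_valP i) (enum_valP j).
  by apply: two_orbits_split E; rewrite evals_orbits ?enum_valP.
rewrite -[in RHS](fix_u k fix_k).
by rewrite (mulmx_perm_repr (lmul_acts H) _ _ (Ej : _ = lmul_action _ _ _)).
Qed.

End CosetModule.

(** * The eigenvalue afforded by the [n-1,1]-module *)

Theorem theorem3p5 (n : nat) (H : {group 'S_n}) (d : nat)
    (S : {set {set 'S_n}})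
    (X : {set {set 'S_n} * {set 'S_n}}) :
  let Omega := lcosets H [set: 'S_n] in
  (2 <= n)%N ->
  gelfand_pair [set: 'S_n]%G H ->
  second_largest (Lambda H) [:: n.-1; 1%N] ->
  S \in orbit (lmul_action 'S_n) (Young_subgroup n [:: n.-1; 1%N]) @: Omega ->
  is_orbital Omega (lmul_action 'S_n) [set: 'S_n] X ->
  out_regular Omega X d ->
  coclique X S ->
  eigenvalue_afforded (coset_repr H) (adjacency Omega X)
    [:: n.-1; 1%N] (- (d%:R * #|S|%:R / (#|Omega|%:R - #|S|%:R))).
Proof.
move=> Omega; case: n => [|[|m]] // in H S X Omega *.
rewrite [m.+2.-1]/= => _ _ [top [_ _ LambdaH _ _]] orbitS orbX outX coclS.
have two_orbits := Lambda_two_orbits LambdaH; set a := - _.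
have invX (g : 'S_m.+2) x y :
    ((lmul_action _ x g, lmul_action _ y g) \in X) = ((x, y) \in X).
  by apply: is_orbitalJ orbX _; rewrite inE.
have commA g : coset_repr H g *m (adjacency Omega X)^T =
    (adjacency Omega X)^T *m coset_repr H g.
  by apply: adjacency_perm_repr; rewrite ?inE //; apply: invX.
split=> [|U /specht_submodule_image[D sub_U homD]].
  exact: exists_specht_submodule.
have /submxP[c ->] := sub_U.
have sub_stable := stable_vec_sub m.
have const_fixed g : coset_repr H g *m const_mx 1 = const_mx 1 :> 'cV_#|Omega|.
  by apply: perm_repr_const; rewrite inE.
have fixed (k : 'S_m.+2) : k ord_max = ord_max ->
    stable_vec m *m D *m coset_repr H k = stable_vec m *m D.
  by move=> fix_k; rewrite -homD // stable_vecM fix_k.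
(* [U] lies in the image of the Specht module under [D], so the equation is needed only there. *)
suff eigW : specht_mx m.+2 [:: m.+1; 1%N] algC *m D *m (adjacency Omega X)^T =
    a *: (specht_mx m.+2 [:: m.+1; 1%N] algC *m D).
  by rewrite -mulmxA eigW -scalemxAr.
apply: (stable_vec_eigen homD) => //.
apply: coclique_eigenvector coclS outX _ _ _ _.
- exact: point_orbit_proper.
- exact: point_orbit_neq0 orbitS.
- exact: fixed_constant_on_split.
- apply: fixed_constant_on_split => // k fix_k.
  by rewrite -mulmxA -commA mulmxA fixed.
(* The coordinate sum is an invariant functional, and remains one after composition with the
   adjacency matrix. *)
- exact: (invariant_functional0 homD).
rewrite -mulmxA; apply: (invariant_functional0 homD) => // g.
by rewrite mulmxA commA -mulmxA const_fixed.
Qed.
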